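(* The family of powered Catalan inversion sequences grows according to the following succession rule: \[\Omega_{pCat}=\left\{\begin{array}{l}(1)\\ (k)\rightsquigarrow (1),(2)^2,(3)^3,\ldots,(k)^k,(k+1).\end{array}\right.\]
   Context: An inversion sequence of length (size) $n\ge 1$ is an integer sequence $e=(e_1,\ldots,e_n)$ with $0\le e_i<i$ for all $i$. A powered Catalan inversion sequence is an element of $\mathbf{I}(=,>,>)$, i.e. an inversion sequence with no three indices $i<j<k$ such that $e_i=e_j>e_k$ (equivalently, avoiding the pattern $110$). A generating tree for a combinatorial class $\mathcal{C}$ (with finitely many objects of each size and exactly one object of size $1$) is an infinite rooted tree whose vertices are the objects of $\mathcal{C}$, each appearing exactly once, with objects of size $n$ at level $n$ (the root being at level $1$); the children of an object $c$ are obtained by adding to $c$ an atom (a piece of object increasing the size by $1$) following some prescribed rules. A succession rule consists of a starting label (the axiom) and, for each label, a multiset of produced labels (its productions). The class $\mathcal{C}$ grows according to a succession rule $\Omega$ if there are a generating tree for $\mathcal{C}$ and an assignment of labels to the objects of $\mathcal{C}$ such that the root carries the axiom and, for each object with label $\ell$, the multiset of labels of its children is exactly the multiset of productions of $\ell$ in $\Omega$. An exponent on a label denotes multiplicity. In the rule above, the axiom is $(1)$ and label $(k)$ produces $(j)$ with multiplicity $j$ for each $1\le j\le k$, and $(k+1)$ once. *)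

(* Defs.v *)
From mathcomp Require Import all_boot.
Set Implicit Arguments.
Unset Strict Implicit.
Unset Printing Implicit Defensive.

(* [obj 0] plays no role: sizes, hence levels of generating trees, start at 1.
   [adds_atom c d] says that [d] arises from [c] by adding one atom. *)
Record comb_class := CombClass {
  obj : nat -> finType;
  adds_atom : forall n, obj n -> obj n.+1 -> bool;
  obj1_unique : #|obj 1| = 1
}.

Definition generating_tree (C : comb_class)
    (children : forall n, obj C n -> {set obj C n.+1}) : Prop :=
  (forall n (c : obj C n) (d : obj C n.+1),
     0 < n -> d \in children n c -> adds_atom c d) /\
  (forall n (d : obj C n.+1),
     0 < n -> exists! c : obj C n, d \in children n c).

(* The multiset of productions is a sequence considered up to [perm_eq]. *)
Record succession_rule (L : eqType) := SuccessionRule {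
  start_label : L;
  productions : L -> seq L
}.

Definition grows_according (C : comb_class) (L : eqType)
    (Omega : succession_rule L) : Prop :=
  exists (children : forall n, obj C n -> {set obj C n.+1})
         (label : forall n, obj C n -> L),
    [/\ generating_tree children,
        forall root : obj C 1, label 1 root = start_label Omega
      & forall n (c : obj C n), 0 < n ->
          perm_eq [seq label n.+1 d | d in children n c]
                  (productions Omega (label n c))].

(* Positions are numbered from 0, so the condition e_i < i on positions
   1, ..., n becomes e i <= i. *)
Definition inversion_sequence n (e : {ffun 'I_n -> 'I_n}) : bool :=
  [forall i, e i <= i].

Definition avoids_110 n (e : {ffun 'I_n -> 'I_n}) : bool :=
  [forall i : 'I_n, forall j : 'I_n, forall k : 'I_n,
     ~~ [&& i < j, j < k, e i == e j & e k < e j]].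

Definition pcat_seq n : finType :=
  {e : {ffun 'I_n -> 'I_n} | inversion_sequence e && avoids_110 e}.

(* The atom is an entry, inserted at some position p. The entries to its left
   are kept; those to its right move one place, which relaxes their upper
   bounds by 1, and each of them is kept or raised by 1. This is how inversion
   tables (e_i = number of larger values to the left of position i) behave when
   a new element is inserted into a permutation; appending a last entry is the
   case p = n. *)
Definition adds_entry n (c : pcat_seq n) (d : pcat_seq n.+1) : bool :=
  [exists p : 'I_n.+1, forall i : 'I_n,
     val c i <= val d (lift p i) <= val c i + (p <= i)].

Lemma pcat_seq1_unique : #|pcat_seq 1| = 1.
Proof.
have e0P : inversion_sequence [ffun _ : 'I_1 => ord0 : 'I_1]
        && avoids_110 [ffun _ : 'I_1 => ord0 : 'I_1].
  apply/andP; split; first by apply/forallP => i; rewrite ffunE.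
  apply/forallP => i; apply/forallP => j; apply/forallP => k.
  by rewrite !ord1.
pose e0 : pcat_seq 1 :=
  exist (fun e => inversion_sequence e && avoids_110 e) _ e0P.
apply/eqP/fintype1P; exists e0 => e.
by apply/val_inj/ffunP => i; rewrite !ord1.
Qed.

Definition powered_catalan : comb_class :=
  @CombClass pcat_seq adds_entry pcat_seq1_unique.

(* Labels are positive integers; the value 0 of [nat] is never produced. *)
Definition Omega_pCat : succession_rule nat :=
  {| start_label := 1;
     productions := fun k =>
       rcons (flatten [seq nseq j j | j <- iota 1 k]) k.+1 |}.

(* Main.v *)
Require Import Defs.
From mathcomp Require Import all_boot zify.

Set Implicit Arguments.
Unset Strict Implicit.
Unset Printing Implicit Defensive.

(** The label of an inversion sequence is its number of zeros, and the parent
    of [d] is obtained by deleting its first entry (a zero) and lowering every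
    positive entry by 1. Read backwards: to grow [c], put a zero in
    front, raise every positive entry by 1, and for each zero of [c] choose
    whether it stays 0 or becomes 1.

    Raising creates no occurrence of 110 whose repeated value is at least 2
    unless [c] already had one, and a repeated 0 never starts an occurrence.
    So only the repeated value 1 matters: the child avoids 110 exactly when the
    0/1 word written on the [k] zeros of [c] avoids 110. In such a word
    every bit after the second one is a one, so a word with at least one one is 0^a 1 0^(j-1-a) 1^(k-j) with [a < j <= k]
    ([word110_codeP]). Together with the leading zero the child has [j] zeros,
    and there are [j] choices of [a]: these are the productions (j)^j. The word
    without ones gives the production (k+1).

    [expand c (j, a)] is the child with code [(j, a)]; the children of [c]
    are exactly these, without repetition ([children_expand]), and the child
    with code [(j, a)] has [j] zeros ([card_zeros_expand]). *)

(** * Binary words avoiding 110 *)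

(** Codes of the words of length [k] that avoid 110: in [(j, a)], the first one
    is at position [a] and the final block of ones starts at position [j]. The
    word without ones gets [(k.+1, k)], whose two positions lie beyond its end,
    so that the first component is always one more than the number of zeros. *)
Definition codes k : seq (nat * nat) :=
  rcons [seq (j, a) | j <- iota 1 k, a <- iota 0 j] (k.+1, k).

Definition word (p : nat * nat) (m : nat) : bool := (m == p.2) || (p.1 <= m).

Lemma mem_codes k j a :
  ((j, a) \in codes k) = (a < j <= k) || ((j == k.+1) && (a == k)).
Proof.
rewrite mem_rcons inE xpair_eqE orbC; congr (_ || _).
apply/allpairsPdep/idP => [[x [y [xk yx [-> ->]]]]|H].
  by move: xk yx; rewrite !mem_iota; lia.
by exists j, a; rewrite !mem_iota; split=> //; lia.
Qed.

Lemma fst_codes k :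
  [seq p.1 | p <- codes k] = productions Omega_pCat k.
Proof.
rewrite /codes map_rcons /=; congr rcons.
rewrite map_flatten -map_comp; congr flatten; apply: eq_map => j /=.
rewrite -map_comp -[X in nseq X _](size_iota 0 j).
by elim: (iota 0 j) => //= x s ->.
Qed.

Lemma uniq_codes k : uniq (codes k).
Proof.
rewrite rcons_uniq; apply/andP; split.
  by apply/negP => /allpairsPdep [x [y []]]; rewrite !mem_iota => + + []; lia.
by apply: allpairs_uniq_dep => [|j _|[x y] [x' y'] _ _ [-> ->]];
  rewrite ?iota_uniq.
Qed.

(** Appending a bit to a word: a zero can be appended only while there is at
    most one one, that is, while the final block is empty. *)
Lemma word110_codeP k (b : nat -> bool) :
  (forall x y z, x < y -> y < z -> z < k -> b x -> b y -> b z) ->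
  exists2 p, p \in codes k & forall m, m < k -> b m = word p m.
Proof.
elim: k => [|k IHk] b110; first by exists (1, 0).
have [|[j a] ja bE] := IHk.
  by move=> x y z xy yz zk; apply: (b110 x y z xy yz); apply: ltnW.
suff [p pk pE] : exists2 p, p \in codes k.+1 &
    (forall m, m < k -> word p m = word (j, a) m) /\ b k = word p k.
  exists p => // m; rewrite ltnS leq_eqVlt => /predU1P[->|mk].
    by case: pE.
  by rewrite bE // pE.1.
move: ja; rewrite mem_codes => /orP[ajk|/andP[/eqP-> /eqP->]]; last first.
  case bk: (b k); [exists (k.+1, k)|exists (k.+2, k.+1)];
    rewrite ?mem_codes /word /=; try split; try (move=> m mk); lia.
have [jk|kj] := ltnP j k.
  have bk : b k.
    by apply: (b110 a j k) => //; rewrite ?bE /word /=; lia.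
  exists (j, a); first by rewrite mem_codes; lia.
  by split=> //; rewrite bk /word /=; lia.
case bk: (b k); [exists (k, a)|exists (k.+1, a)];
  rewrite ?mem_codes /word /=; try split; try (move=> m mk); lia.
Qed.

Lemma word_inj k p q : p \in codes k -> q \in codes k -> p.1 = q.1 ->
  (forall m, m < k -> word p m = word q m) -> p = q.
Proof.
case: p q => [j a] [j' a']; rewrite !mem_codes /word /= => H H' jj' E.
subst j'; congr (_, _); move: (E a) (E a'); lia.
Qed.

Lemma word_avoids110 k p x y z : p \in codes k ->
  x < y -> y < z -> z < k -> word p x -> word p y -> word p z.
Proof. by case: p => j a; rewrite mem_codes /word /=; lia. Qed.

Lemma count_word k p : p \in codes k ->
  (count (fun m => ~~ word p m) (iota 0 k)).+1 = p.1.
Proof.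
case: p => j a; rewrite mem_codes /word /= => H.
have [aE|ajk] : (a = k /\ j = k.+1) \/ a < j <= k by lia.
  rewrite aE.1 aE.2 -[in RHS](size_iota 0 k); congr _.+1.
  by apply/eqP; rewrite -all_count; apply/allP => m; rewrite mem_iota; lia.
have -> : k = (a + (1 + (j - a.+1))) + (k - j) by lia.
rewrite !iotaD !count_cat add0n /=.
have c0 m r : (forall x, m <= x < m + r -> (x == a) || (j <= x)) ->
    count (fun x => ~~ ((x == a) || (j <= x))) (iota m r) = 0.
  move=> h; apply/eqP; rewrite -leqn0 leqNgt -has_count.
  by apply/hasPn => x; rewrite mem_iota negbK => /h.
have c1 m r : (forall x, m <= x < m + r -> ~~ ((x == a) || (j <= x))) ->
    count (fun x => ~~ ((x == a) || (j <= x))) (iota m r) = r.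
  move=> h; rewrite -[RHS](size_iota m r); apply/eqP.
  by rewrite -all_count; apply/allP => x; rewrite mem_iota => /h.
by rewrite [X in _ + X]c0 ?c1 => [|x|x|x]; lia.
Qed.

(** * Zeros of an inversion sequence *)

Section Zeros.
Variable n : nat.
Implicit Types (e : {ffun 'I_n -> 'I_n}) (i l : 'I_n).

Definition zeros e : {set 'I_n} := [set i | e i == 0 :> nat].

Definition zero_rank e i : nat := #|[set l in zeros e | l < i]|.

Lemma zero_rank_lt e i l : i \in zeros e -> l \in zeros e ->
  (zero_rank e i < zero_rank e l) = (i < l).
Proof.
have lt_rank i' l' : i' \in zeros e -> i' < l' -> zero_rank e i' < zero_rank e l'.
  move=> i0 il; apply/proper_card/properP; split.
    by apply/subsetP => x; rewrite !inE; lia.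
  by exists i'; move: i0; rewrite !inE; lia.
move=> i0 l0; case: (ltngtP i l) => [il|li|/ord_inj->].
- exact: lt_rank.
- by have := lt_rank _ _ l0 li; lia.
- by rewrite ltnn.
Qed.

Lemma zero_rank_inj e : {in zeros e &, injective (zero_rank e)}.
Proof.
move=> i l i0 l0 E; apply: ord_inj.
by have := zero_rank_lt i0 l0; have := zero_rank_lt l0 i0; rewrite E; lia.
Qed.

Lemma zero_rank_perm e :
  perm_eq [seq zero_rank e i | i <- enum (zeros e)] (iota 0 #|zeros e|).
Proof.
have rank_uniq : uniq [seq zero_rank e i | i <- enum (zeros e)].
  rewrite map_inj_in_uniq ?enum_uniq // => i l; rewrite !mem_enum.
  exact: zero_rank_inj.
apply: uniq_perm (iota_uniq _ _) _ => //.
apply: (uniq_min_size rank_uniq _ _).2; last by rewrite size_map size_iota cardE.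
move=> _ /mapP[i + ->]; rewrite mem_enum mem_iota /= add0n => i0.
apply/proper_card/properP; split; first by apply/subsetP => x; rewrite !inE; lia.
by exists i; rewrite // inE ltnn andbF.
Qed.

Lemma zero_rank_max e i : i \in zeros e -> zero_rank e i < #|zeros e|.
Proof.
move=> i0; have: zero_rank e i \in iota 0 #|zeros e|.
  by rewrite -(perm_mem (zero_rank_perm e)) map_f ?mem_enum.
by rewrite mem_iota.
Qed.

Lemma zero_rank_surj e m : m < #|zeros e| ->
  exists2 i, i \in zeros e & zero_rank e i = m.
Proof.
move=> mk; have: m \in iota 0 #|zeros e| by rewrite mem_iota.
rewrite -(perm_mem (zero_rank_perm e)) => /mapP[i].
by rewrite mem_enum => i0 ->; exists i.
Qed.

Lemma avoids110P e :
  reflect (forall i j k : 'I_n, i < j -> j < k -> e i = e j -> e j <= e k)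
          (avoids_110 e).
Proof.
apply: (iffP forallP) => [H i j k ij jk E|H i].
  have /forallP/(_ j)/forallP/(_ k) := H i.
  by rewrite ij jk E eqxx /= -leqNgt.
apply/forallP => j; apply/forallP => k.
apply/negP => /and4P[ij jk /eqP E]; have := H i j k ij jk E; lia.
Qed.

End Zeros.

(** * Parent and children *)

Section Growth.
Variable n : nat.
Implicit Types (c : {ffun 'I_n -> 'I_n}) (d : {ffun 'I_n.+1 -> 'I_n.+1}).

Lemma ordS_ind (P : 'I_n.+1 -> Prop) :
  P ord0 -> (forall i : 'I_n, P (lift ord0 i)) -> forall x, P x.
Proof. by move=> P0 PS x; case: (unliftP ord0 x) => [i ->|->] //; apply: PS. Qed.

(* [insubd] always succeeds here: the default [i] is never used. *)
Definition contract d : {ffun 'I_n -> 'I_n} :=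
  [ffun i => insubd i (d (lift ord0 i)).-1].

Definition expand c (p : nat * nat) : {ffun 'I_n.+1 -> 'I_n.+1} :=
  [ffun i => if unlift ord0 i is Some l then
     inord (if l \in zeros c then word p (zero_rank c l) : nat else (c l).+1)
   else ord0].

Lemma contractE d i : contract d i = (d (lift ord0 i)).-1 :> nat.
Proof.
rewrite ffunE val_insubd.
by have := ltn_ord (d (lift ord0 i)); have := ltn_ord i; case: ifP; lia.
Qed.

Lemma expand0 c p : expand c p ord0 = ord0.
Proof. by rewrite ffunE unlift_none. Qed.

Lemma expandS c p i : expand c p (lift ord0 i) =
  (if i \in zeros c then word p (zero_rank c i) : nat else (c i).+1) :> nat.
Proof.
rewrite ffunE liftK inordK //.
have := ltn_ord (c i); have := ltn_ord i; case: ifP => _; last lia.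
by case: word; lia.
Qed.

Lemma expandK c p : contract (expand c p) = c.
Proof.
apply/ffunP => i; apply/val_inj; rewrite /= contractE expandS inE.
by case: eqP => [->|_ //]; case: word.
Qed.

Lemma inversion_contract d : d ord0 = ord0 ->
  inversion_sequence (contract d) = inversion_sequence d.
Proof.
move=> d0; apply/forallP/forallP => H i.
  elim/ordS_ind: i => [|l]; first by rewrite d0.
  by have := H l; rewrite contractE /= /bump /=; lia.
by have := H (lift ord0 i); rewrite contractE /= /bump /=; lia.
Qed.

Lemma inversion_head d : inversion_sequence d -> d ord0 = ord0.
Proof. by move/forallP/(_ ord0) => /= H; apply/val_inj => /=; lia. Qed.

Lemma avoids_contract d : avoids_110 d -> avoids_110 (contract d).
Proof.
move=> /avoids110P H; apply/avoids110P => i j k ij jk /(congr1 val) /=.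
rewrite !contractE => E; rewrite leqNgt; apply/negP => kj.
have /H : lift ord0 i < lift ord0 j by rewrite /= /bump /=; lia.
move/(_ (lift ord0 k)); rewrite {1}/lift /= /bump /=.
have dij : d (lift ord0 i) = d (lift ord0 j) by apply/ord_inj; lia.
by move=> /(_ _ dij); lia.
Qed.

(** An occurrence of 110 in [d] has a positive repeated value, so it misses the
    leading zero; if that value is at least 2 the occurrence survives in
    [contract d], which leaves the value 1. *)
Lemma avoids_of_contract d : d ord0 = ord0 -> avoids_110 (contract d) ->
  (forall i j k : 'I_n, i < j -> j < k -> d (lift ord0 i) = 1 :> nat ->
     d (lift ord0 j) = 1 :> nat -> d (lift ord0 k) != 0 :> nat) ->
  avoids_110 d.
Proof.
move=> d0 /avoids110P H H1; apply/avoids110P.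
elim/ordS_ind => [|i]; first by rewrite d0 => j k _ _ <-.
elim/ordS_ind => [|j]; first by rewrite d0.
elim/ordS_ind => [|k]; first by rewrite /= /bump.
rewrite /= /bump /= => ij' jk' E.
have ij : i < j by lia.
have jk : j < k by lia.
have := H i j k ij jk; rewrite !contractE.
have := H1 i j k ij jk; rewrite E.
have -> : contract d i = contract d j by apply/val_inj; rewrite /= !contractE E.
by move=> + /(_ erefl); lia.
Qed.

Lemma inversion_expand c p :
  inversion_sequence (expand c p) = inversion_sequence c.
Proof. by rewrite -{2}(expandK c p) inversion_contract // expand0. Qed.

Lemma avoids_expand c p : p \in codes #|zeros c| -> avoids_110 c ->
  avoids_110 (expand c p).
Proof.
move=> pc c110; apply: avoids_of_contract; rewrite ?expand0 ?expandK //.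
move=> i j k ij jk; rewrite !expandS.
case: ifP => i0; last by move: i0; rewrite inE; lia.
case: ifP => j0; last by move: j0; rewrite inE; lia.
case: ifP => // k0 wi wj.
have rij : zero_rank c i < zero_rank c j by rewrite zero_rank_lt.
have rjk : zero_rank c j < zero_rank c k by rewrite zero_rank_lt.
by rewrite (word_avoids110 pc rij rjk (zero_rank_max k0)) //; lia.
Qed.

Lemma card_zeros_expand c p : p \in codes #|zeros c| ->
  #|zeros (expand c p)| = p.1.
Proof.
move=> pc; rewrite -(count_word pc) -(permP (zero_rank_perm c)) count_map.
rewrite -size_filter.
have -> : zeros (expand c p) =
    ord0 |: lift ord0 @: [set i in zeros c | ~~ word p (zero_rank c i)].
  apply/setP => x; rewrite 3!inE.
  elim/ordS_ind: x => [|i]; first by rewrite expand0 !eqxx.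
  rewrite expandS (mem_imset _ _ (@lift_inj _ ord0)) lift_eqF.
  by rewrite [RHS]inE /=; case: ifP => // _; case: word.
rewrite cardsU1 (card_imset _ (@lift_inj _ ord0)).
have -> : ord0 \notin
    lift ord0 @: [set i in zeros c | ~~ word p (zero_rank c i)].
  by apply/imsetP => -[i _] /eqP; rewrite eq_liftF.
rewrite add1n cardE; congr _.+1; apply/perm_size/uniq_perm.
- exact: enum_uniq.
- by rewrite filter_uniq ?enum_uniq.
- by move=> i; rewrite mem_enum !inE mem_filter mem_enum !inE andbC.
Qed.

Lemma expand_inj c : {in codes #|zeros c| &, injective (expand c)}.
Proof.
move=> p q pc qc E; apply: (word_inj pc qc).
  by rewrite -(card_zeros_expand pc) E card_zeros_expand.
move=> m /zero_rank_surj[i i0 <-].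
move: (congr1 (fun d : {ffun 'I_n.+1 -> 'I_n.+1} => d (lift ord0 i) : nat) E).
by rewrite !expandS i0; do 2 case: word.
Qed.

(** The code is read off the 0/1 word that [d] writes on the zeros of its
    parent. *)
Lemma contract_expand d : inversion_sequence d -> avoids_110 d ->
  exists2 p, p \in codes #|zeros (contract d)| & d = expand (contract d) p.
Proof.
move=> /inversion_head d0 /avoids110P H; set c := contract d.
pose b m :=
  [exists i in zeros c, (zero_rank c i == m) && (d (lift ord0 i) == 1 :> nat)].
have bE i : i \in zeros c -> b (zero_rank c i) = (d (lift ord0 i) == 1 :> nat).
  move=> i0; apply/exists_inP/idP => [[l l0 /andP[/eqP r]]|di].
    by rewrite (zero_rank_inj l0 i0 r).
  by exists i; rewrite // eqxx.
have [|p pc pE] := @word110_codeP #|zeros c| b.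
  move=> x y z xy yz zk.
  have [k k0 kE] := zero_rank_surj zk.
  have [j j0 jE] := zero_rank_surj (ltn_trans yz zk).
  have [i i0 iE] := zero_rank_surj (ltn_trans xy (ltn_trans yz zk)).
  move: xy yz; rewrite -{}kE -{}jE -{}iE !bE // !zero_rank_lt // => ij jk di dj.
  have := H (lift ord0 i) (lift ord0 j) (lift ord0 k).
  have E : d (lift ord0 i) = d (lift ord0 j) by apply/ord_inj; lia.
  rewrite E /= /bump /= => /(_ _ _ erefl).
  by move: k0; rewrite inE contractE; lia.
exists p => //; apply/ffunP; elim/ordS_ind => [|i]; apply/ord_inj.
  by rewrite d0 expand0.
have := contractE d i; rewrite -/c expandS; case: ifP => i0 cE.
  rewrite -pE ?zero_rank_max // bE //.
  by move: i0; rewrite inE cE; case: (val (d _)) => [|[|m]].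
by move: i0; rewrite inE cE; case: (val (d _)).
Qed.

End Growth.

(** * The generating tree *)

Lemma contract_pcat n (d : pcat_seq n.+1) :
  inversion_sequence (contract (val d)) && avoids_110 (contract (val d)).
Proof.
have /andP[di d110] := valP d.
by rewrite inversion_contract ?di ?avoids_contract // inversion_head.
Qed.

Definition parent n (d : pcat_seq n.+1) : pcat_seq n :=
  exist (fun e => inversion_sequence e && avoids_110 e) _ (contract_pcat d).

Definition children n (c : pcat_seq n) : {set pcat_seq n.+1} :=
  [set d | parent d == c].

Lemma children_expand n (c : pcat_seq n) :
  perm_eq [seq val d | d <- enum (children c)]
          [seq expand (val c) p | p <- codes #|zeros (val c)|].
Proof.
apply: uniq_perm.
- by rewrite map_inj_uniq ?enum_uniq //; apply: val_inj.
- by rewrite map_inj_in_uniq ?uniq_codes //; apply: expand_inj.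
have /andP[ci c110] := valP c.
move=> d; apply/mapP/mapP => [[d' + ->]|[p pc ->]].
  rewrite mem_enum inE => /eqP <- /=.
  by have /andP[di d110] := valP d'; apply: contract_expand.
have dP : inversion_sequence (expand (val c) p) && avoids_110 (expand (val c) p).
  by rewrite inversion_expand ci avoids_expand.
exists (exist (fun e => inversion_sequence e && avoids_110 e) _ dP) => //.
by rewrite mem_enum inE; apply/eqP/val_inj; rewrite /= expandK.
Qed.

(** The new entry is always the leading zero: all other entries move one place
    to the right and are kept or raised by 1. *)
Lemma adds_entry_children n (c : pcat_seq n) d :
  d \in children c -> adds_entry c d.
Proof.
rewrite inE => /eqP <-; apply/existsP; exists ord0; apply/forallP => i.
by rewrite contractE /=; lia.
Qed.

Theorem proposition19 : grows_according powered_catalan Omega_pCat.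
Proof.
exists children, (fun n (c : pcat_seq n) => #|zeros (val c)|); split.
- split=> [n c d _|n d _]; first exact: adds_entry_children.
  exists (parent d); split=> [|c]; first by rewrite inE.
  by rewrite inE => /eqP.
- move=> root; rewrite /= -[RHS](card_ord 1) -cardsT; congr #|pred_of_set _|.
  by apply/setP => i; rewrite !inE !ord1.
move=> n c _; rewrite -fst_codes.
rewrite /image_mem (map_comp (fun e => #|zeros e|) val).
rewrite (perm_trans (perm_map _ (children_expand c))) // -map_comp.
by rewrite (_ : map _ _ = [seq p.1 | p <- codes #|zeros (val c)|]) //;
  apply/eq_in_map => p pc; rewrite /= card_zeros_expand.
Qed.
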